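(* Let $m,n\ge1$. The map sending a positive integral frieze $F$ on $A_{m,n}$ to the family $u_{i,j}=F(\gamma_{i,j})$, $i,j\in\mathbb Z$, is a bijection between positive integral friezes on $A_{m,n}$ and positive integral $(m,n)$-periodic bi-infinite quasi-friezes.
   Context: A bi-infinite quasi-frieze (BiQF) is a family $(u_{i,j})_{i,j\in\mathbb Z}$ of real numbers satisfying $u_{i,j}u_{i+1,j+1}-u_{i,j+1}u_{i+1,j}=-1$ for all $i,j$; positive integral if all entries are positive integers; $(m,n)$-periodic if $u_{i+m,j+n}=u_{i,j}$ for all $i,j$. $A_{m,n}$ is an annulus with marked points $P_1,\dots,P_m$ on one boundary component and $Q_1,\dots,Q_n$ on the other. An arc is a non-contractible simple curve with endpoints at marked points, up to isotopy; boundary segments between consecutive marked points are arcs too. A quadrilateral $ABCD$ is a collection of pairwise non-crossing arcs $AB,BC,CD,DA$ cutting out a disc with vertices in this cyclic order. A positive integral frieze assigns a positive integer $F(\gamma)$ to every arc with $F=1$ on boundary segments and $F(AC)F(BD)=F(AB)F(CD)+F(BC)F(AD)$ for every quadrilateral $ABCD$. In the universal cover (an infinite strip) marked points lift to $\hat P_i$, $\hat Q_j$ ($i,j\in\mathbb Z$) on the two boundary lines, $\hat P_i$ over $P_{i'}$ with $i'\equiv i\pmod m$, $\hat Q_j$ over $Q_{j'}$ with $j'\equiv j\pmod n$, deck generator $\hat P_i\mapsto\hat P_{i+m}$, $\hat Q_j\mapsto\hat Q_{j+n}$, labels chosen so that $\hat P_i,\hat P_{i+1},\hat Q_{j+1},\hat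 Q_j$ form a quadrilateral in this cyclic order. $\gamma_{i,j}$ is the bridging arc that is the image of the segment $\hat P_i\hat Q_j$. *)

(* Defs.v *)
From HB Require Import structures.
From mathcomp Require Import all_boot all_order all_algebra.
From mathcomp Require Import zify.
From mathcomp Require Import boolp classical_sets functions reals.

Set Implicit Arguments.
Unset Strict Implicit.
Unset Printing Implicit Defensive.

Import Order.TTheory GRing.Theory Num.Theory.

Local Open Scope classical_set_scope.
Local Open Scope ring_scope.

(* Lifts of the marked points of A_{m,n} to the universal cover, a strip. *)
Inductive mpoint := Phat of int | Qhat of int.

Definition deck (m n : nat) (k : int) (a : mpoint) : mpoint :=
  match a with
  | Phat i => Phat (i + k * m%:Z)
  | Qhat j => Qhat (j + k * n%:Z)
  end.

(* The strip is a disc with two boundary points removed. Walking once around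
   its boundary, starting at a removed point, one meets the Phat_i with i
   increasing and then the Qhat_j with j decreasing. *)
Definition before (a b : mpoint) : bool :=
  match a, b with
  | Phat i, Phat j => i < j
  | Phat _, Qhat _ => true
  | Qhat _, Phat _ => false
  | Qhat i, Qhat j => j < i
  end.

Definition increasing (a b c d : mpoint) : bool :=
  [&& before a b, before b c & before c d].

Definition positively_ordered (a b c d : mpoint) : bool :=
  [|| increasing a b c d, increasing b c d a, increasing c d a b
    | increasing d a b c].

(* a, b, c, d are distinct and met in this cyclic order along the boundary of
   the strip, in one of its two orientations. *)
Definition cyclically_ordered (a b c d : mpoint) : bool :=
  positively_ordered a b c d || positively_ordered d c b a.

(* The strip being a disc, a curve in it joining two boundary points is
   determined up to isotopy by its endpoints, and the curves with endpoints
   e.1, e.2 and f.1, f.2 are forced to cross exactly when the endpoints of one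
   separate those of the other on the boundary; otherwise they can be made
   disjoint away from common endpoints, simultaneously for all the lifts of a
   family of curves in the annulus. *)
Definition crossing (e f : mpoint * mpoint) : bool :=
  cyclically_ordered e.1 f.1 e.2 f.2.

(* A curve of the annulus with endpoints at marked points is recorded, up to
   isotopy, by the set of its lifts, each given by its endpoints (in either
   order, curves being unoriented): this is the orbit of one of them. *)
Definition curve_lifts (m n : nat) (a b : mpoint) : set (mpoint * mpoint) :=
  [set e | exists k : int, e = (deck m n k a, deck m n k b) \/
                           e = (deck m n k b, deck m n k a)].

Definition noncrossing (X Y : set (mpoint * mpoint)) : Prop :=
  forall e f, X e -> Y f -> ~~ crossing e f.

(* An arc: non-contractible, i.e. its lifts are not closed, and simple, i.e.
   its lifts do not cross one another. *)
Definition is_arc (m n : nat) (X : set (mpoint * mpoint)) : Prop :=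
  exists a b, [/\ X = curve_lifts m n a b, a <> b & noncrossing X X].

Record annulus_arc (m n : nat) := Arc {
  lifts :> set (mpoint * mpoint);
  lifts_arc : is_arc m n lifts
}.

Definition boundary_segment m n (x : annulus_arc m n) : Prop :=
  exists i : int, lifts x (Phat i, Phat (i + 1)) \/
                  lifts x (Qhat i, Qhat (i + 1)).

(* x1, x2, x3, x4 are the sides AB, BC, CD, DA of a quadrilateral ABCD. The
   disc they cut out lifts to the strip, where it has vertices a, b, c, d.
   Conversely, for vertices of the strip in this order whose sides satisfy the
   noncrossing conditions, the disc they cut out in the strip does not overlap
   its translates, so it projects to a disc of the annulus; hence also the diagonals, with
   lifts (a, c) and (b, d), are arcs. *)
Definition quadrilateral m n (a b c d : mpoint) (x1 x2 x3 x4 : annulus_arc m n) : Prop :=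
  [/\ cyclically_ordered a b c d,
      [/\ lifts x1 (a, b), lifts x2 (b, c), lifts x3 (c, d) & lifts x4 (d, a)],
      [/\ noncrossing x1 x2, noncrossing x1 x3 & noncrossing x1 x4]
    & [/\ noncrossing x2 x3, noncrossing x2 x4 & noncrossing x3 x4]].

Definition positive_integral_frieze m n (F : annulus_arc m n -> nat) : Prop :=
  [/\ forall x, (0 < F x)%N,
      forall x, boundary_segment x -> F x = 1%N
    & forall a b c d (AB BC CD DA AC BD : annulus_arc m n),
        quadrilateral a b c d AB BC CD DA ->
        lifts AC (a, c) -> lifts BD (b, d) ->
        (F AC * F BD = F AB * F CD + F BC * F DA)%N].

Lemma bridging_is_arc m n i j : is_arc m n (curve_lifts m n (Phat i) (Qhat j)).
Proof.
exists (Phat i), (Qhat j); split=> // e f [k [] ->] [l [] ->];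
  rewrite /crossing /cyclically_ordered /positively_ordered /increasing /=;
  rewrite ?andbF ?andbT ?orbF ?orFb /= ?ltrD2l.
all: apply/negP; have [kl|kl] := leP k l; nia.
Qed.

(* The bridging arc gamma_{i,j}, image of the segment from Phat_i to Qhat_j. *)
Definition gamma m n (i j : int) : annulus_arc m n := Arc (bridging_is_arc m n i j).

Definition biqf (R : realType) (u : int -> int -> R) : Prop :=
  forall i j, u i j * u (i + 1) (j + 1) - u i (j + 1) * u (i + 1) j = -1.

Definition positive_integral (R : realType) (u : int -> int -> R) : Prop :=
  forall i j, u i j \is a Num.int /\ 0 < u i j.

Definition periodic (R : realType) (m n : nat) (u : int -> int -> R) : Prop :=
  forall i j, u (i + m%:Z) (j + n%:Z) = u i j.

(* Main.v *)
Require Import Defs.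
From mathcomp Require Import all_boot all_order all_algebra.
From mathcomp Require Import zify ring lra.
From mathcomp Require Import boolp classical_sets functions reals.

Set Implicit Arguments.
Unset Strict Implicit.
Unset Printing Implicit Defensive.

Import Order.TTheory GRing.Theory Num.Theory.

Local Open Scope classical_set_scope.
Local Open Scope ring_scope.

(** A positive quasi-frieze [u] has rank two: its rows satisfy a three-term
    linear recurrence whose coefficients do not depend on the column.  Hence
    there are plane vectors [p_i], [q_j] with [u i j = det (p_i, q_j)].  Giving
    an arc with lift [(a, b)] the value [|det (v_a, v_b)|] extends [u] to all
    arcs, and the Ptolemy relations become the Pluecker relation in the plane.
    Conversely, the quadrilateral on a peripheral arc and a boundary segment of
    the other component expresses the value of the former through bridging
    arcs, so a frieze is determined by its bridging arcs. *)

(** * Arcs of the annulus *)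

Lemma annulus_arc_inj m n (x y : annulus_arc m n) : lifts x = lifts y -> x = y.
Proof.
case: x y => [X hX] [Y hY] /= eXY; case: _ / eXY hY => hY.
by rewrite (Prop_irrelevance hX hY).
Qed.

Lemma deckD m n k l a : deck m n k (deck m n l a) = deck m n (l + k) a.
Proof. by case: a => i /=; rewrite mulrDl addrA. Qed.

Lemma curve_liftsC m n a b : curve_lifts m n a b = curve_lifts m n b a.
Proof. by apply/seteqP; split=> e [k [] ->]; exists k; [right|left|right|left]. Qed.

Lemma curve_lifts_refl m n a b : curve_lifts m n a b (a, b).
Proof. by exists 0; left; case: a b => i [] j /=; rewrite !mul0r !addr0. Qed.

Lemma curve_lifts_deck m n k a b :
  curve_lifts m n (deck m n k a) (deck m n k b) = curve_lifts m n a b.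
Proof.
apply/seteqP; split=> e [l h].
  by exists (k + l); rewrite !deckD in h.
by exists (l - k); rewrite !deckD [k + _]addrC subrK.
Qed.

Lemma curve_lifts_eq m n a b c d :
  curve_lifts m n a b (c, d) -> curve_lifts m n a b = curve_lifts m n c d.
Proof.
case=> k [] [-> ->]; first by rewrite curve_lifts_deck.
by rewrite curve_lifts_deck curve_liftsC.
Qed.

Lemma liftsE m n (x : annulus_arc m n) a b :
  lifts x (a, b) -> lifts x = curve_lifts m n a b.
Proof.
by case: (lifts_arc x) => c [d [-> _ _]] /curve_lifts_eq.
Qed.

Lemma gamma_deck m n k i j :
  gamma m n (i + k * m%:Z) (j + k * n%:Z) = gamma m n i j.
Proof.
by apply: annulus_arc_inj; rewrite /= -(curve_lifts_deck m n k (Phat i)).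
Qed.

Lemma positively_ordered_rot a b c d :
  positively_ordered a b c d = positively_ordered b c d a.
Proof. by rewrite /positively_ordered orbC -!orbA. Qed.

Lemma crossing_flipl a b f : crossing (b, a) f = crossing (a, b) f.
Proof.
rewrite /crossing /cyclically_ordered /= orbC.
by rewrite (positively_ordered_rot f.2 a) (positively_ordered_rot f.2 b).
Qed.

Lemma crossing_flipr e c d : crossing e (d, c) = crossing e (c, d).
Proof.
rewrite /crossing /cyclically_ordered /= orbC.
by rewrite (positively_ordered_rot e.1 c) (positively_ordered_rot e.1 d).
Qed.

(** Comparing [k] with [l] yields linear bounds between their products with [m] and [n], so that
    [lia] can treat these products as atoms. The symmetry of [crossing] disposes of the order of
    endpoints. *)
Lemma noncrossing_translates m n a b c d :
  (forall k l : int,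
     k * m%:Z + m%:Z <= l * m%:Z /\ k * n%:Z + n%:Z <= l * n%:Z \/
     l * m%:Z + m%:Z <= k * m%:Z /\ l * n%:Z + n%:Z <= k * n%:Z \/ k = l ->
   ~~ crossing (deck m n k a, deck m n k b) (deck m n l c, deck m n l d)) ->
  noncrossing (curve_lifts m n a b) (curve_lifts m n c d).
Proof.
move=> h e f [k he] [l hf].
have {}h : ~~ crossing (deck m n k a, deck m n k b) (deck m n l c, deck m n l d).
  apply: h; have [kl|kl|->] := ltrgtP k l; [left; nia|right; left; nia|by right; right].
by case: he hf => -> [] -> //;
  [rewrite crossing_flipr|rewrite crossing_flipl|rewrite crossing_flipl crossing_flipr].
Qed.

Ltac solve_noncrossing :=
  apply: noncrossing_translates => ? ?;
  rewrite /crossing /cyclically_ordered /positively_ordered /increasing /=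
    ?andbF ?andbT ?orbF ?orFb //=; lia.

(** The equality [j = i + m] is a loop around the annulus: its successive lifts share an endpoint
    but do not cross. *)
Lemma noncrossing_PP m n i j : i < j -> j <= i + m%:Z ->
  noncrossing (curve_lifts m n (Phat i) (Phat j)) (curve_lifts m n (Phat i) (Phat j)).
Proof. move=> h1 h2; solve_noncrossing. Qed.

Lemma noncrossing_QQ m n i j : i < j -> j <= i + n%:Z ->
  noncrossing (curve_lifts m n (Qhat j) (Qhat i)) (curve_lifts m n (Qhat j) (Qhat i)).
Proof. move=> h1 h2; solve_noncrossing. Qed.

Lemma is_arc_PP m n i j : i < j -> j <= i + m%:Z ->
  is_arc m n (curve_lifts m n (Phat i) (Phat j)).
Proof.
move=> ij ji; exists (Phat i), (Phat j); split=> //; last exact: noncrossing_PP.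
by case=> e; rewrite e ltxx in ij.
Qed.

Lemma is_arc_QQ m n i j : i < j -> j <= i + n%:Z ->
  is_arc m n (curve_lifts m n (Qhat j) (Qhat i)).
Proof.
move=> ij ji; exists (Qhat j), (Qhat i); split=> //; last exact: noncrossing_QQ.
by case=> e; rewrite e ltxx in ij.
Qed.

(** A longer lift would cross its image under the deck generator, because
    [i < i + m < j < j + m]. *)
Lemma noncrossing_PP_width m n i j : i < j ->
  noncrossing (curve_lifts m n (Phat i) (Phat j)) (curve_lifts m n (Phat i) (Phat j)) ->
  (0 < m)%N -> j <= i + m%:Z.
Proof.
move=> ij h m0; rewrite leNgt; apply/negP => hlt.
have /negP := h (Phat i, Phat j) (deck m n 1 (Phat i), deck m n 1 (Phat j))
  (curve_lifts_refl _ _ _ _) (ex_intro _ 1 (or_introl erefl)).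
apply; rewrite /crossing /cyclically_ordered /positively_ordered /increasing /=; lia.
Qed.

Lemma noncrossing_QQ_width m n i j : i < j ->
  noncrossing (curve_lifts m n (Qhat j) (Qhat i)) (curve_lifts m n (Qhat j) (Qhat i)) ->
  (0 < n)%N -> j <= i + n%:Z.
Proof.
move=> ij h n0; rewrite leNgt; apply/negP => hlt.
have /negP := h (Qhat j, Qhat i) (deck m n 1 (Qhat j), deck m n 1 (Qhat i))
  (curve_lifts_refl _ _ _ _) (ex_intro _ 1 (or_introl erefl)).
apply; rewrite /crossing /cyclically_ordered /positively_ordered /increasing /=; lia.
Qed.

Inductive arc_spec m n (x : annulus_arc m n) : Prop :=
| Bridging i j of x = gamma m n i j
| PeripheralP i j of i < j & j <= i + m%:Z & lifts x (Phat i, Phat j)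
| PeripheralQ i j of i < j & j <= i + n%:Z & lifts x (Qhat j, Qhat i).

(** Reversing a lift if necessary puts its endpoints in the order wanted by [arc_spec]; simplicity
    then bounds the width of peripheral arcs. *)
Lemma arcP m n (x : annulus_arc m n) : (0 < m)%N -> (0 < n)%N -> arc_spec x.
Proof.
move=> m0 n0; case: (lifts_arc x) => -[] i [[] j [ex nij nc]].
- have [ij|ji|ij] := ltrgtP i j; last by case: nij; rewrite ij.
  + apply: (PeripheralP ij); last by rewrite ex; apply: curve_lifts_refl.
    by rewrite ex in nc; apply: noncrossing_PP_width nc _.
  + rewrite curve_liftsC in ex.
    apply: (PeripheralP ji); last by rewrite ex; apply: curve_lifts_refl.
    by rewrite ex in nc; apply: noncrossing_PP_width nc _.
- by apply: (@Bridging _ _ _ i j); apply: annulus_arc_inj.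
- by apply: (@Bridging _ _ _ j i); apply: annulus_arc_inj; rewrite ex curve_liftsC.
- have [ij|ji|ij] := ltrgtP i j; last by case: nij; rewrite ij.
  + rewrite curve_liftsC in ex.
    apply: (PeripheralQ ij); last by rewrite ex; apply: curve_lifts_refl.
    by rewrite ex in nc; apply: noncrossing_QQ_width nc _.
  + apply: (PeripheralQ ji); last by rewrite ex; apply: curve_lifts_refl.
    by rewrite ex in nc; apply: noncrossing_QQ_width nc _.
Qed.

(** * Quadrilaterals joining the two boundary components *)

Lemma quadrilateral_PPQQ m n i j k l (x y : annulus_arc m n) :
  i < j -> j <= i + m%:Z -> k < l -> l <= k + n%:Z ->
  lifts x (Phat i, Phat j) -> lifts y (Qhat l, Qhat k) ->
  quadrilateral (Phat i) (Phat j) (Qhat l) (Qhat k)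
    x (gamma m n j l) y (gamma m n i k).
Proof.
move=> ij ji kl lk hx hy; split=> //.
- by rewrite /cyclically_ordered /positively_ordered /increasing /= ij kl.
- by split=> //=; [|rewrite curve_liftsC]; apply: curve_lifts_refl.
(* The width bounds keep all translates of the bridging sides from ending strictly under a lift of
   [x] or [y]. *)
- by rewrite (liftsE hx) (liftsE hy) /=; split; clear -ij ji kl lk; solve_noncrossing.
- by rewrite (liftsE hy) /=; split; clear -ij ji kl lk; solve_noncrossing.
Qed.

Lemma frieze_PPQQ m n (F : annulus_arc m n -> nat) i j k l (x y : annulus_arc m n) :
  positive_integral_frieze F ->
  i < j -> j <= i + m%:Z -> k < l -> l <= k + n%:Z ->
  lifts x (Phat i, Phat j) -> lifts y (Qhat l, Qhat k) ->
  (F (gamma m n i l) * F (gamma m n j k) =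
     F x * F y + F (gamma m n j l) * F (gamma m n i k))%N.
Proof.
move=> [_ _ FP] ij ji kl lk hx hy.
apply: FP (quadrilateral_PPQQ ij ji kl lk hx hy) _ _; exact: curve_lifts_refl.
Qed.

Lemma ltz_addr1 (i : int) : i < i + 1. Proof. lia. Qed.

Lemma lez_add1n (m : nat) (i : int) : (0 < m)%N -> i + 1 <= i + m%:Z.
Proof. lia. Qed.

Definition segmentP m n (m0 : (0 < m)%N) (i : int) : annulus_arc m n :=
  Arc (is_arc_PP n (ltz_addr1 i) (lez_add1n i m0)).

Definition segmentQ m n (n0 : (0 < n)%N) (i : int) : annulus_arc m n :=
  Arc (is_arc_QQ m (ltz_addr1 i) (lez_add1n i n0)).

Lemma segmentP_boundary m n m0 i : boundary_segment (@segmentP m n m0 i).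
Proof. by exists i; left; apply: curve_lifts_refl. Qed.

Lemma segmentQ_boundary m n n0 i : boundary_segment (@segmentQ m n n0 i).
Proof. by exists i; right; rewrite /= curve_liftsC; apply: curve_lifts_refl. Qed.

Lemma frieze_biqf m n (F : annulus_arc m n -> nat) i j :
  (0 < m)%N -> (0 < n)%N -> positive_integral_frieze F ->
  (F (gamma m n i (j + 1)) * F (gamma m n (i + 1) j) =
     1 + F (gamma m n i j) * F (gamma m n (i + 1) (j + 1)))%N.
Proof.
move=> m0 n0 hF; have [_ F1 _] := hF.
rewrite (frieze_PPQQ (x := segmentP n m0 i) (y := segmentQ m n0 j) hF) ?ltz_addr1 ?lez_add1n //.
- rewrite (F1 _ (segmentP_boundary n m0 i)) (F1 _ (segmentQ_boundary m n0 j)).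
  by rewrite [X in (_ + X)%N]mulnC.
- exact: curve_lifts_refl.
- exact: curve_lifts_refl.
Qed.

Lemma frieze_bridging_inj m n (F G : annulus_arc m n -> nat) :
  (0 < m)%N -> (0 < n)%N ->
  positive_integral_frieze F -> positive_integral_frieze G ->
  (forall i j, F (gamma m n i j) = G (gamma m n i j)) -> F = G.
Proof.
move=> m0 n0 hF hG FG; have [_ F1 _] := hF; have [_ G1 _] := hG.
apply: funext => x; case: (arcP x m0 n0) => [i j -> //|i j ij ji hx|i j ij ji hx].
(* With a segment of value 1 opposite [x], the value at [x] is the only term of the relation not
   already known to agree. *)
- have s1 := segmentQ_boundary m n0 0; have s2 := curve_lifts_refl m n (Qhat 1) (Qhat 0).
  have := frieze_PPQQ hF ij ji (ltz_addr1 0) (lez_add1n 0 n0) hx (y := segmentQ m n0 0) s2.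
  have := frieze_PPQQ hG ij ji (ltz_addr1 0) (lez_add1n 0 n0) hx (y := segmentQ m n0 0) s2.
  rewrite (F1 _ s1) (G1 _ s1) !FG !muln1 => -> /eqP; rewrite eqn_add2r => /eqP //.
- have s1 := segmentP_boundary n m0 0; have s2 := curve_lifts_refl m n (Phat 0) (Phat 1).
  have := frieze_PPQQ hF (ltz_addr1 0) (lez_add1n 0 m0) ij ji (x := segmentP n m0 0) s2 hx.
  have := frieze_PPQQ hG (ltz_addr1 0) (lez_add1n 0 m0) ij ji (x := segmentP n m0 0) s2 hx.
  rewrite (F1 _ s1) (G1 _ s1) !FG !mul1n => -> /eqP; rewrite eqn_add2r => /eqP //.
Qed.

(** * Integral quasi-friezes as determinants *)

Lemma int_updown (P : int -> Prop) :
  P 0 -> (forall i, P i -> P (i + 1)) -> (forall i, P (i + 1) -> P i) ->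
  forall i, P i.
Proof.
move=> P0 Pup Pdown; elim=> [//|k|k] IHk.
  by rewrite -addn1 PoszD; apply: Pup.
by apply: Pdown; have -> : - k.+1%:Z + 1 = - k%:Z by lia.
Qed.

Definition int_biqf (U : int -> int -> int) : Prop :=
  forall i j, U i (j + 1) * U (i + 1) j = 1 + U i j * U (i + 1) (j + 1).

(** Subtracting the relations for rows [i, i + 1] and [i + 1, i + 2] cancels the constant 1 and
    shows that the ratio of [U i k + U (i + 2) k] to [U (i + 1) k] is the same at [k] and [k + 1].
    Cross-multiplication keeps this within the integers. *)
Lemma biqf_row_sum_proportional U i j :
  int_biqf U -> (forall i j, 0 < U i j) ->
  (U i j + U (i + 1 + 1) j) * U (i + 1) 0 =
  (U i 0 + U (i + 1 + 1) 0) * U (i + 1) j.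
Proof.
move=> hU U0.
have step k : (U i (k + 1) + U (i + 1 + 1) (k + 1)) * U (i + 1) k =
              (U i k + U (i + 1 + 1) k) * U (i + 1) (k + 1).
  have := hU i k; have := hU (i + 1) k; lia.
have nz k : U (i + 1) k != 0 by rewrite gt_eqF.
elim/int_updown: j => [//|j IHj|j IHj]; have := step j => sj.
- apply: (mulIf (nz j)).
  rewrite mulrAC sj -mulrA [U _ (j + 1) * _]mulrC mulrA IHj; ring.
- apply: (mulIf (nz (j + 1))).
  rewrite mulrAC -sj -mulrA [U _ j * _]mulrC mulrA IHj; ring.
Qed.

Definition det2 (v w : int * int) : int := v.1 * w.2 - v.2 * w.1.

Lemma det2C v w : det2 v w = - det2 w v.
Proof. rewrite /det2; ring. Qed.

Lemma det2_plucker a b c d :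
  det2 a c * det2 b d = det2 a b * det2 c d + det2 b c * det2 a d.
Proof. rewrite /det2; ring. Qed.

(* The vector of [Phat i] is [U i 0 * q_1 - U i 1 * q_0], where [q_j] is the
   vector of [Qhat j]; as [det (q_1, q_0) = 1], it is the only vector whose
   determinants with [q_0] and [q_1] are [U i 0] and [U i 1]. *)
Definition mvec (U : int -> int -> int) (a : mpoint) : int * int :=
  match a with
  | Phat i => (U i 0 * U 0 1 - U i 1 * U 0 0, U i 0 * U 1 1 - U i 1 * U 1 0)
  | Qhat j => (U 0 j, U 1 j)
  end.

Definition mdet U (a b : mpoint) : int := det2 (mvec U a) (mvec U b).

Lemma mdet_plucker U a b c d :
  mdet U a c * mdet U b d = mdet U a b * mdet U c d + mdet U b c * mdet U a d.
Proof. exact: det2_plucker. Qed.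

Lemma mdet_PQ U i j :
  int_biqf U -> (forall i j, 0 < U i j) -> mdet U (Phat i) (Qhat j) = U i j.
Proof.
move=> hU U0; have nz k l : U k l != 0 by rewrite gt_eqF.
have e0 := hU 0 0; rewrite !add0r in e0.
(* The recurrence has order two, so the induction carries two consecutive rows. *)
suff [] : mdet U (Phat i) (Qhat j) = U i j /\
          mdet U (Phat (i + 1)) (Qhat j) = U (i + 1) j by [].
(* The vector of [Phat k] is linear in [U k 0] and [U k 1], so the determinants inherit the row
   recurrence from columns 0 and 1. *)
have rec k :
    (mdet U (Phat k) (Qhat j) + mdet U (Phat (k + 1 + 1)) (Qhat j)) * U (k + 1) 0 =
    (U k 0 + U (k + 1 + 1) 0) * mdet U (Phat (k + 1)) (Qhat j).
  have e1 := biqf_row_sum_proportional k 1 hU U0.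
  rewrite /mdet /det2 /=.
  transitivity ((U k 0 + U (k + 1 + 1) 0) * U (k + 1) 0 * (U 0 1 * U 1 j - U 1 1 * U 0 j)
    - (U k 1 + U (k + 1 + 1) 1) * U (k + 1) 0 * (U 0 0 * U 1 j - U 1 0 * U 0 j)); first ring.
  rewrite e1; ring.
elim/int_updown: i => [|i [IH1 IH2]|i [IH1 IH2]].
- rewrite add0r /mdet /det2 /=; split.
  + transitivity (U 0 j * (U 0 1 * U 1 0 - U 0 0 * U 1 1)); first ring.
    by rewrite e0; ring.
  + transitivity (U 1 j * (U 0 1 * U 1 0 - U 0 0 * U 1 1)); first ring.
    by rewrite e0; ring.
- split=> //; apply: (mulIf (nz (i + 1) 0)).
  have := rec i; rewrite IH1 IH2 -(biqf_row_sum_proportional i j hU U0) !mulrDl.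
  by move/addrI.
- split=> //; apply: (mulIf (nz (i + 1) 0)).
  have := rec i; rewrite IH1 IH2 -(biqf_row_sum_proportional i j hU U0) !mulrDl.
  by move/addIr.
Qed.

Lemma mdet_QQ1 U j : int_biqf U -> mdet U (Qhat (j + 1)) (Qhat j) = 1.
Proof. by move=> /(_ 0 j); rewrite add0r /mdet /det2 /=; lia. Qed.

(** Pluecker relation with [Qhat (k + 1)] and [Qhat k], whose determinant is 1. The freedom in [k]
    is what gives deck invariance below. *)
Lemma mdet_PP U i j k : int_biqf U -> (forall i j, 0 < U i j) ->
  mdet U (Phat i) (Phat j) = U i (k + 1) * U j k - U j (k + 1) * U i k.
Proof.
move=> hU U0; have UE k' l' := mdet_PQ k' l' hU U0.
rewrite -!UE mdet_plucker mdet_QQ1 // mulr1 addrK //.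
Qed.

Lemma mdet_PP1 U i : int_biqf U -> (forall i j, 0 < U i j) ->
  mdet U (Phat i) (Phat (i + 1)) = 1.
Proof. by move=> hU U0; rewrite (mdet_PP _ _ 0) // hU; ring. Qed.

Lemma mdet_QQ U i k l : int_biqf U -> (forall i j, 0 < U i j) ->
  mdet U (Qhat l) (Qhat k) = U i l * U (i + 1) k - U (i + 1) l * U i k.
Proof.
move=> hU U0; have UE k' l' := mdet_PQ k' l' hU U0.
rewrite -!UE mdet_plucker mdet_PP1 // mul1r addrK //.
Qed.

(** For two points on one boundary line, induction on their distance: a Pluecker relation with a
    point of the other line writes the new determinant, times a positive entry, as a sum of two
    positive products. *)
Lemma mdet_gt0 U a b : int_biqf U -> (forall i j, 0 < U i j) ->
  before a b -> 0 < mdet U a b.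
Proof.
move=> hU U0; have pos i j : 0 < mdet U (Phat i) (Qhat j) by rewrite mdet_PQ.
case: a b => i [] j //= ij.
- have -> : j = i + 1 + `|(j - i - 1)%R|%N%:Z by lia.
  elim: `|_|%N => [|k IHk]; first by rewrite addr0 mdet_PP1.
  rewrite -addn1 PoszD addrA; set j' := i + 1 + k%:Z in IHk *.
  rewrite -(pmulr_lgt0 _ (pos j' 0)) mdet_plucker.
  by rewrite mdet_PP1 // addr_gt0 ?mulr_gt0.
- have -> : i = j + 1 + `|(i - j - 1)%R|%N%:Z by lia.
  elim: `|_|%N => [|k IHk]; first by rewrite addr0 mdet_QQ1.
  rewrite -addn1 PoszD addrA; set i' := j + 1 + k%:Z in IHk *.
  rewrite -(pmulr_rgt0 _ (pos 0 i')) mdet_plucker.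
  by rewrite mdet_QQ1 // addr_gt0 ?mulr_gt0.
Qed.

Lemma periodic_deck U (m n : nat) (k i j : int) :
  (forall i j, U (i + m%:Z) (j + n%:Z) = U i j) ->
  U (i + k * m%:Z) (j + k * n%:Z) = U i j :> int.
Proof.
move=> Uper; elim/int_updown: k => [|k IHk|k IHk].
- by rewrite !mul0r !addr0.
- by rewrite !mulrDl !mul1r !addrA Uper.
- by rewrite -IHk !mulrDl !mul1r !addrA Uper.
Qed.

Lemma mdet_deck U (m n : nat) k a b : int_biqf U -> (forall i j, 0 < U i j) ->
  (forall i j, U (i + m%:Z) (j + n%:Z) = U i j) ->
  mdet U (deck m n k a) (deck m n k b) = mdet U a b.
Proof.
move=> hU U0 Uper; have per i j := periodic_deck k i j Uper.
case: a b => i [] j /=.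
(* The auxiliary column on the left is the deck translate of the one on the right, so both
   expansions match by periodicity. *)
- by rewrite (mdet_PP _ _ (0 + k * n%:Z)) // (mdet_PP i j 0) // [_ + _ + 1]addrAC !per.
- by rewrite !mdet_PQ.
- rewrite /mdet det2C [RHS]det2C; congr (- _).
  by rewrite -/(mdet U (Phat _) (Qhat _)) -/(mdet U (Phat j) (Qhat i)) !mdet_PQ.
- by rewrite (mdet_QQ (0 + k * m%:Z)) // (mdet_QQ 0 j i) // [_ + _ + 1]addrAC !per.
Qed.

(** * The frieze given by absolute values of determinants *)

Definition mnorm U (a b : mpoint) : nat := `|mdet U a b|%N.

Lemma mnormC U a b : mnorm U a b = mnorm U b a.
Proof. by rewrite /mnorm /mdet det2C abszN. Qed.

Lemma before_trans a b c : before a b -> before b c -> before a c.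
Proof. by case: a b c => i [] j [] k //=; lia. Qed.

Lemma before_total a b : a <> b -> before a b \/ before b a.
Proof.
case: a b => i [] j nij /=; [|by left|by right|];
  have [ij|ij|ij] := ltrgtP i j; by [left|right|case: nij; rewrite ij].
Qed.

Lemma mnorm_gt0 U a b : int_biqf U -> (forall i j, 0 < U i j) ->
  a <> b -> (0 < mnorm U a b)%N.
Proof.
by move=> hU U0 /before_total[] h; [|rewrite mnormC];
  rewrite /mnorm absz_gt0 gt_eqF ?mdet_gt0.
Qed.

(** In this order all six determinants are positive, so absolute values leave the Pluecker relation
    unchanged. *)
Lemma mnorm_ptolemy_increasing U a b c d :
  int_biqf U -> (forall i j, 0 < U i j) -> increasing a b c d ->
  (mnorm U a c * mnorm U b d = mnorm U a b * mnorm U c d + mnorm U b c * mnorm U a d)%N.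
Proof.
move=> hU U0 /and3P[ab bc cd].
have ac := before_trans ab bc; have bd := before_trans bc cd.
have ad := before_trans ab bd.
have E x y : before x y -> (mnorm U x y)%:Z = mdet U x y.
  by move=> /(mdet_gt0 hU U0) h; rewrite /mnorm gtz0_abs.
apply/eqP; rewrite -eqz_nat PoszD !PoszM !E //; apply/eqP; exact: mdet_plucker.
Qed.

(** Rotating or reversing the four vertices preserves the Ptolemy relation, which reduces every
    cyclic order to the increasing one. *)
Lemma mnorm_ptolemy U a b c d :
  int_biqf U -> (forall i j, 0 < U i j) -> cyclically_ordered a b c d ->
  (mnorm U a c * mnorm U b d = mnorm U a b * mnorm U c d + mnorm U b c * mnorm U d a)%N.
Proof.
move=> hU U0 /orP[] /or4P[] /(mnorm_ptolemy_increasing hU U0);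
  rewrite ?(mnormC U d) ?(mnormC U c a) ?(mnormC U b a) ?(mnormC U c b); lia.
Qed.

Lemma arc_lift_ex m n (x : annulus_arc m n) :
  exists e, lifts x e /\ e.1 <> e.2.
Proof.
case: (lifts_arc x) => a [b [-> ab _]]; exists (a, b); split=> //.
exact: curve_lifts_refl.
Qed.

Definition arc_lift m n (x : annulus_arc m n) : mpoint * mpoint :=
  sval (cid (arc_lift_ex x)).

Definition frieze_of U m n (x : annulus_arc m n) : nat :=
  mnorm U (arc_lift x).1 (arc_lift x).2.

(** Two lifts of an arc differ by a deck transformation and possibly a swap of endpoints, so the
    lift picked by choice is immaterial. *)
Lemma frieze_ofE U m n (x : annulus_arc m n) a b :
  int_biqf U -> (forall i j, 0 < U i j) ->
  (forall i j, U (i + m%:Z) (j + n%:Z) = U i j) ->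
  lifts x (a, b) -> frieze_of U x = mnorm U a b.
Proof.
move=> hU U0 Uper xab; rewrite /frieze_of /arc_lift; case: cid => e [xe _] /=.
move: xe; rewrite (liftsE xab) => -[k [] ->] /=; last rewrite mnormC.
all: by rewrite /mnorm mdet_deck.
Qed.

Lemma frieze_of_frieze U m n :
  int_biqf U -> (forall i j, 0 < U i j) ->
  (forall i j, U (i + m%:Z) (j + n%:Z) = U i j) ->
  positive_integral_frieze (frieze_of U (m := m) (n := n)).
Proof.
move=> hU U0 Uper; split.
- move=> x; rewrite /frieze_of /arc_lift; case: cid => e [_ ne] /=.
  exact: mnorm_gt0.
- move=> x [i [] /(frieze_ofE hU U0 Uper) ->]; last rewrite mnormC.
    by rewrite /mnorm mdet_PP1.
  by rewrite /mnorm mdet_QQ1.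
- move=> a b c d AB BC CD DA AC BD [abcd [hAB hBC hCD hDA] _ _] hAC hBD.
  rewrite (frieze_ofE hU U0 Uper hAB) (frieze_ofE hU U0 Uper hBC).
  rewrite (frieze_ofE hU U0 Uper hCD) (frieze_ofE hU U0 Uper hDA).
  rewrite (frieze_ofE hU U0 Uper hAC) (frieze_ofE hU U0 Uper hBD).
  exact: mnorm_ptolemy.
Qed.

Theorem theorem4p2 (R : realType) (m n : nat) (hm : (1 <= m)%N) (hn : (1 <= n)%N) :
  set_bij [set F : annulus_arc m n -> nat | positive_integral_frieze F]
          [set u : int -> int -> R |
             [/\ biqf u, positive_integral u & periodic m n u]]
          (fun F i j => (F (gamma m n i j))%:R).
Proof.
split.
- move=> F /= hF; split.
  + move=> i j; rewrite -!natrM mulnC [(F (gamma m n i (j + 1)) * _)%N]frieze_biqf //.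
    by rewrite mulnC natrD opprD addrCA subrr addr0.
  + by move=> i j; rewrite natr_int ltr0n; split=> //; case: hF.
  + move=> i j; have := gamma_deck m n 1 i j; by rewrite !mul1r => ->.
- move=> F G; rewrite !inE /= => hF hG FG; apply: frieze_bridging_inj => // i j.
  by apply/eqP; rewrite -(eqr_nat R); apply/eqP; apply: (congr1 (fun f => f i j) FG).
- move=> u /= [hu upos uper].
  (* The entries are integers, so taking floors loses nothing and moves the construction to
     [int]. *)
  pose U i j := Num.floor (u i j).
  have UE i j : (U i j)%:~R = u i j by have [ui _] := upos i j; rewrite floorK.
  have U0 i j : 0 < U i j by rewrite -(ltr0z R) UE; case: (upos i j).
  have hU : int_biqf U.
    move=> i j; apply: (@intr_inj R); rewrite intrD !intrM !UE.
    have := hu i j; lra.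
  have Uper i j : U (i + m%:Z) (j + n%:Z) = U i j by rewrite /U uper.
  exists (frieze_of U (m := m) (n := n)); first exact: frieze_of_frieze.
  apply: funext => i; apply: funext => j.
  rewrite (frieze_ofE (x := gamma m n i j) hU U0 Uper (curve_lifts_refl m n (Phat i) (Qhat j))).
  by rewrite /mnorm mdet_PQ // -UE natr_absz gtr0_norm.
Qed.
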